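(* For $n\ge2$ let $(G(n),\boldsymbol{x}(n))$ be the tree consisting of a vertex $u$ adjacent to $v_1,\dots,v_n$ with $x_{u,v_i}=1/n$, and, for each $i$, a set $W_i$ of $n-1$ leaves adjacent only to $v_i$ with $x_{v_i,w}=1/n$ for $w\in W_i$ (the $W_i$ pairwise disjoint). Let $\gamma\approx0.3929$ be the unique solution in $(0,1)$ of $1-2\gamma-\gamma e^{\gamma-1}=0$. Then for any OCRS there is an order presenting first all edges between $\{v_1,\dots,v_n\}$ and $\bigcup_iW_i$ (in an arbitrary order) and then the edges at $u$ (in an order chosen by the adversary depending on the OCRS), under which the OCRS is at most $(\gamma+o(1))$-selectable on $(G(n),\boldsymbol{x}(n))$, i.e., $\min_e\Pr[e\in\mathcal{M}\mid X_e=1]\le\gamma+o(1)$ as $n\to\infty$.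
   Context: Each edge $e$ is independently active ($X_e=1$) with probability $x_e$. An OCRS knows the input, sees edges one at a time in an order fixed in advance by an adversary who knows the OCRS's description, learns $X_e$ on arrival, and irrevocably decides whether to add $e$ to its matching $\mathcal{M}$ (only active edges with both endpoints unmatched may be added). *)

(* Defs.v *)
From HB Require Import structures.
From mathcomp Require Import all_boot all_order all_algebra.
From mathcomp Require Import all_classical all_reals all_analysis.

Set Implicit Arguments.
Unset Strict Implicit.
Unset Printing Implicit Defensive.

Import Order.TTheory GRing.Theory Num.Theory.
Import numFieldNormedType.Exports.
Local Open Scope classical_set_scope.
Local Open Scope ring_scope.

(* A graph on V is given by its set E : {set {set V}} of edges, an edge being
   the pair of its endpoints. *)

(* An arbitrary randomized online scheme: it draws a seed, independent of the
   activity states, from an arbitrary probability space.  [accept w h e] says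
   whether, with seed w, it is willing to take the arriving edge e, if active,
   after having seen the history h (earlier edges in order of arrival, each with
   its state).  Its past decisions are determined by w and h, so they need not
   be recorded in h; neither the states nor the identities of the edges still to
   come are available to it. *)
Record ocrs (R : realType) (V : finType) := Ocrs {
  seed_display : measure_display;
  seed : measurableType seed_display;
  seed_law : probability seed R;
  accept : seed -> seq ({set V} * bool) -> {set V} -> bool;
  accept_measurable : forall h e, measurable [set w | accept w h e]
}.

Section OnlineMatching.
Variables (R : realType) (V : finType).
Implicit Types (E act M : {set {set V}}) (s : seq {set V}) (e : {set V}).

Definition is_order E s := perm_eq s (enum E).

Definition endpoints_free M e := [forall f in M, [disjoint e & f]].

Fixpoint run (acc : seq ({set V} * bool) -> {set V} -> bool) act
    (h : seq ({set V} * bool)) M s : {set {set V}} :=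
  if s is e :: s' then
    run acc act (rcons h (e, e \in act))
      (if [&& e \in act, endpoints_free M e & acc h e] then e |: M else M) s'
  else M.

Definition matching (A : ocrs R V) s (w : seed A) act : {set {set V}} :=
  run (accept w) act [::] finset.set0 s.

Definition activity_weight E (x : {set V} -> R) act : R :=
  \prod_(e in E) (if e \in act then x e else 1 - x e).

(* Probability under the product of the law of the active set and that of the
   seed. *)
Definition Pr E (x : {set V} -> R) (A : ocrs R V)
    (ev : seed A -> {set {set V}} -> bool) : R :=
  \sum_(act in powerset E)
    activity_weight E x act * fine (seed_law A [set w | ev w act]).

Definition select_prob E (x : {set V} -> R) (A : ocrs R V) s e : R :=
  Pr E x (fun (w : seed A) act => (e \in matching s w act) && (e \in act))
  / Pr E x (fun (_ : seed A) act => e \in act).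

(* The default value 1 is harmless: conditional probabilities are at most 1. *)
Definition selectability E (x : {set V} -> R) (A : ocrs R V) s : R :=
  \big[Num.min/1]_(e in E) select_prob E x A s e.

End OnlineMatching.

Definition tree_vertex (n : nat) : finType :=
  (unit + 'I_n + 'I_n * 'I_n.-1)%type.

Definition tree_u (n : nat) : tree_vertex n := inl (inl tt).
Definition tree_v (n : nat) (i : 'I_n) : tree_vertex n := inl (inr i).
Definition tree_w (n : nat) (i : 'I_n) (j : 'I_n.-1) : tree_vertex n :=
  inr (i, j).

Definition root_edges (n : nat) : {set {set tree_vertex n}} :=
  [set [set tree_u n; tree_v i] | i : 'I_n]%SET.

Definition leaf_edges (n : nat) : {set {set tree_vertex n}} :=
  [set [set tree_v i; tree_w i j] | i : 'I_n, j : 'I_n.-1]%SET.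

Definition tree_edges (n : nat) : {set {set tree_vertex n}} :=
  (leaf_edges n :|: root_edges n)%SET.

Definition tree_x (R : realType) (n : nat) (_ : {set tree_vertex n}) : R :=
  n%:R^-1.

Definition gamma_eq (R : realType) (g : R) : Prop :=
  0 < g < 1 /\ 1 - 2 * g - g * expR (g - 1) = 0.

(* Main.v *)
(** The adversary presents the root edges with a well-chosen one last. Fix the seed,
    let [F] be the set of children left free by the leaf edges and [Z = |F| / n].
    The last edge [u v_i] can only be taken if [v_i] is free and [u] is not yet taken, and
    [u] can only be taken if some [u v_k] with [k] in [F] is active; the latter has
    probability [1 - (1 - 1/n)^(n Z)] given [F], since [F] depends on the leaf edges only.
    Averaging over [i] therefore yields
      P(last edge taken | active) + P(u taken before) <= E[Z + (1 - Z) (1 - e^-Z)] + O(1/n),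
    and [1 - E Z] is the average over the children of the sum of the selection probabilities
    of their leaf edges. Replacing the concave function by its tangent at [1 - gamma], of
    slope [kappa = e^(gamma - 1) (1 + gamma)], makes this an inequality linear in the
    selection probabilities, which may be integrated over the seed. If every edge were
    selected with probability [c] for every choice of the last edge, this would give
    [(2 + kappa) c <= (2 + kappa) gamma + O(1/n)]. *)

Require Import Defs.
From HB Require Import structures.
From mathcomp Require Import all_boot all_order all_algebra.
From mathcomp Require Import ring lra.
From mathcomp Require Import all_classical all_reals all_analysis.
From mathcomp Require Import measurable_realfun.

Import Order.TTheory GRing.Theory Num.Theory.
Import numFieldNormedType.Exports.
Local Open Scope classical_set_scope.
Local Open Scope ring_scope.

Set Implicit Arguments.
Unset Strict Implicit.
Unset Printing Implicit Defensive.

(** * Runs of a scheme with a fixed seed *)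

Section Run.
Variables (V : finType) (acc : seq ({set V} * bool) -> {set V} -> bool).
Implicit Types (act M : {set {set V}}) (s : seq {set V}) (e : {set V}).

Lemma run_cat act h M s t :
  run acc act h M (s ++ t) =
  run acc act (h ++ [seq (e, e \in act) | e <- s]) (run acc act h M s) t.
Proof. by elim: s h M => [|e s IH] h M /=; rewrite ?cats0 ?IH ?cat_rcons. Qed.

Lemma run_subset act h M s : M \subset run acc act h M s.
Proof.
elim: s h M => [|e s IH] h M //=; apply: fintype.subset_trans (IH _ _).
by case: ifP => // _; apply: finset.subsetUr.
Qed.

Lemma mem_run act h M s e :
  e \in run acc act h M s -> e \in M \/ (e \in s /\ e \in act).
Proof.
elim: s h M => [|f s IH] h M /=; first by left.
case/IH => [|[es eact]]; last by right; rewrite inE es orbT.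
case: ifP => [/and3P[fact _ _]|_]; last by left.
rewrite in_setU1 => /orP[/eqP->|]; last by left.
by right; rewrite mem_head.
Qed.

(** The online property: states of edges outside [s] cannot influence the run. All independence used
    later comes from here. *)
Lemma eq_run act act' h M s : {in s, act =i act'} ->
  run acc act h M s = run acc act' h M s.
Proof.
elim: s h M => [|f s IH] h M //= actE.
rewrite actE ?mem_head //; apply: IH => e es.
by apply: actE; rewrite inE es orbT.
Qed.

Lemma run_disjoint act h M s :
  {in M &, forall e f, e != f -> [disjoint e & f]%B} ->
  {in run acc act h M s &, forall e f, e != f -> [disjoint e & f]%B}.
Proof.
elim: s h M => [|g s IH] h M //= Mdis; apply: IH.
case: ifP => // /and3P[_ /forall_inP free _] e f.
rewrite !in_setU1 => /orP[/eqP->|eM] /orP[/eqP->|fM]; first by rewrite eqxx.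
- by move=> _; apply: free.
- by move=> _; rewrite disjoint_sym; apply: free.
- exact: Mdis.
Qed.

End Run.

(** By induction on the arrivals: an active edge with free endpoints splits the seed space along its
    acceptance event, and any other edge leaves it whole. *)
Lemma measurable_run (R : realType) (V : finType) (A : ocrs R V)
    (Q : {set {set V}} -> bool) act h M s :
  measurable [set w | Q (run (@accept _ _ A w) act h M s)].
Proof.
elim: s h M => [|e s IH] h M /=.
  case: (Q M); first by rewrite (_ : [set _ | _] = setT) //; apply/seteqP; split.
  by rewrite (_ : [set _ | _] = set0) //; apply/seteqP; split.
have [ok|nok] := boolP ((e \in act) && endpoints_free M e); last first.
  have e0 (w : seed A) : [&& e \in act, endpoints_free M e & accept w h e] = false.
    by rewrite andbA (negbTE nok).
  rewrite (_ : [set _ | _] = [set w | Q (run (@accept _ _ A w) act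
                              (rcons h (e, e \in act)) M s)]); first exact: IH.
  by apply/seteqP; split=> w /=; rewrite e0.
pose S := [set w | @accept _ _ A w h e].
have mS : measurable S by exact: accept_measurable.
pose B N := [set w | Q (run (@accept _ _ A w) act (rcons h (e, e \in act)) N s)].
rewrite (_ : [set _ | _] = (S `&` B (e |: M)%SET) `|` (~` S `&` B M)).
  apply: measurableU; apply: measurableI; [exact: mS|exact: IH| |exact: IH].
  exact: measurableC.
apply/seteqP; rewrite /S /B; split=> w /=; rewrite andbA ok /=.
  by case: ifP => ?; [left|right].
by case=> -[]; [move=> ->|move=> /negP/negbTE->].
Qed.

(** * Expectation under the product law of the active set *)

Section Expectation.
Variables (R : realType) (V : finType) (x : {set V} -> R).
Implicit Types (A B E K : {set {set V}}) (f g : {set {set V}} -> R).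

Definition Ex E f : R := \sum_(act in powerset E) activity_weight E x act * f act.

Lemma eq_Ex E f g : {in powerset E, f =1 g} -> Ex E f = Ex E g.
Proof. by move=> fg; apply: eq_bigr => act actE; rewrite fg. Qed.

Lemma Ex_add E f g : Ex E (fun a => f a + g a) = Ex E f + Ex E g.
Proof. by rewrite -big_split; apply: eq_bigr => act _; rewrite mulrDr. Qed.

Lemma Ex_scale E c f : Ex E (fun a => c * f a) = c * Ex E f.
Proof. by rewrite mulr_sumr; apply: eq_bigr => act _; rewrite mulrCA. Qed.

Lemma Ex_sum E (I : Type) (r : seq I) (P : pred I) (f : I -> {set {set V}} -> R) :
  Ex E (fun a => \sum_(i <- r | P i) f i a) = \sum_(i <- r | P i) Ex E (f i).
Proof. by rewrite exchange_big; apply: eq_bigr => act _; rewrite mulr_sumr. Qed.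

Lemma Ex_set0 f : Ex finset.set0 f = f finset.set0.
Proof. by rewrite /Ex powerset0 big_set1 /activity_weight big_set0 mul1r. Qed.

Lemma Ex_set1 e f :
  Ex [set e]%SET f = x e * f [set e]%SET + (1 - x e) * f finset.set0.
Proof.
rewrite /Ex.
have -> : powerset [set e]%SET = [set [set e]; finset.set0]%SET.
  by apply/finset.setP => B; rewrite !inE subset1.
rewrite big_setU1 ?big_set1 /=; last first.
  by rewrite inE; apply/eqP => /finset.setP/(_ e); rewrite !inE eqxx.
by rewrite /activity_weight !big_set1 !inE eqxx.
Qed.

(** Fubini for independent states: a subset of the union is cut into its traces on [A] and [B], and
    the weight, a product over edges, factors accordingly. *)
Lemma Ex_setU A B f : [disjoint A & B]%B ->
  Ex (A :|: B) f = Ex A (fun a => Ex B (fun b => f (a :|: b)%SET)).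
Proof.
move=> dAB; rewrite /Ex; under [RHS]eq_bigr do rewrite mulr_sumr.
rewrite pair_big_dep /=.
rewrite (reindex_onto (fun p => p.1 :|: p.2)%SET
   (fun S => (S :&: A, S :&: B)%SET)) /=; last first.
  by move=> S; rewrite powersetE -finset.setIUr => /finset.setIidPl.
have dis (a b : {set {set V}}) : a \subset A -> b \subset B ->
    ((a :|: b) :&: A = a)%SET /\ ((a :|: b) :&: B = b)%SET.
  move=> aA bB; rewrite !finset.setIUl.
  have dba : (b :&: A = finset.set0)%SET.
    apply/eqP; rewrite finset.setI_eq0 disjoint_sym.
    exact: disjointWr bB dAB.
  have dab : (a :&: B = finset.set0)%SET.
    by apply/eqP; rewrite finset.setI_eq0; apply: disjointWl aA dAB.
  by rewrite dba dab finset.setU0 finset.set0U; split; apply/finset.setIidPl.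
apply: eq_big => [[a b]|[a b]] /=.
  rewrite !powersetE; apply/andP/andP => [[_ /eqP[<- <-]]|[aA bB]].
    by rewrite !finset.subsetIr.
  by have [-> ->] := dis _ _ aA bB; rewrite finset.setUSS.
rewrite !powersetE => /andP[_ /eqP[aE bE]].
have aA : a \subset A by rewrite -aE finset.subsetIr.
have bB : b \subset B by rewrite -bE finset.subsetIr.
rewrite mulrA; congr (_ * _).
rewrite /activity_weight (eq_bigl [predU A & B]) => [|e]; last by rewrite !inE.
rewrite bigU //=; congr (_ * _); apply: eq_bigr => e eA.
  rewrite inE; suff -> : (e \in b) = false by rewrite orbF.
  by apply/negP => /(fintype.subsetP bB); rewrite (disjointFr dAB eA).
rewrite inE; suff -> : (e \in a) = false by [].
by apply/negP => /(fintype.subsetP aA); rewrite (disjointFl dAB eA).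
Qed.

Lemma Ex_cst E c : Ex E (fun=> c) = c.
Proof.
have [k] := ubnP #|E|; elim: k E => // k IH E Ek.
have [->|[e eE]] := set_0Vmem E; first exact: Ex_set0.
rewrite -(finset.setD1K eE) Ex_setU ?disjoints1 ?finset.setD11 // Ex_set1 IH; first by ring.
by move: Ek; rewrite (cardsD1 e E) eE.
Qed.

(** The second hypothesis makes [f] blind to the state of [e], hence independent of it; one splits
    on that state alone. *)
Lemma Ex_active E e (f : {set {set V}} -> R) : e \in E ->
  (forall act, f (e |: act)%SET = f act) ->
  Ex E (fun act => (e \in act)%:R * f act) = x e * Ex E f.
Proof.
move=> eE fe; rewrite -(finset.setD1K eE).
rewrite !Ex_setU ?disjoints1 ?finset.setD11 // !Ex_set1.
have E1 : Ex (E :\ e)%SET (fun b => (e \in [set e] :|: b)%SET%:R * f ([set e] :|: b)%SET)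
        = Ex (E :\ e)%SET f.
  by apply: eq_Ex => b _; rewrite !inE eqxx fe mul1r.
have E2 : Ex (E :\ e)%SET (fun b =>
    (e \in finset.set0 :|: b)%SET%:R * f (finset.set0 :|: b)%SET) = 0.
  rewrite -(Ex_cst (E :\ e)%SET 0); apply: eq_Ex => b.
  rewrite powersetE finset.set0U => /fintype.subsetP bE.
  suff -> : (e \in b) = false by rewrite mul0r.
  by apply/negP => /bE; rewrite !inE eqxx.
have E3 : Ex (E :\ e)%SET (fun b => f ([set e] :|: b)%SET) = Ex (E :\ e)%SET f.
  by apply: eq_Ex => b _; rewrite fe.
have E4 : Ex (E :\ e)%SET (fun b => f (finset.set0 :|: b)%SET) = Ex (E :\ e)%SET f.
  by apply: eq_Ex => b _; rewrite finset.set0U.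
by rewrite E1 E2 E3 E4; ring.
Qed.

(** The edges outside [K] integrate out, and inside [K] only the empty active set survives. *)
Lemma Ex_avoid E K : K \subset E ->
  Ex E (fun act => [disjoint act & K]%B%:R) = \prod_(e in K) (1 - x e).
Proof.
move=> KE; have -> : E = (K :|: E :\: K)%SET.
  by apply/finset.setP => e; rewrite !inE orb_andr orbN /=;
     case: (boolP (e \in K)) => // /(fintype.subsetP KE).
have dK : [disjoint K & (E :\: K)%SET]%B.
  by rewrite -finset.setI_eq0 finset.setIDA finset.setIC -finset.setIDA finset.setDv
             finset.setI0.
rewrite Ex_setU //.
transitivity (Ex K (fun a => (a == finset.set0)%:R)).
  apply: eq_Ex => a; rewrite powersetE => aK.
  rewrite -[RHS](Ex_cst (E :\: K)%SET); apply: eq_Ex => b.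
  rewrite powersetE => bE; congr (nat_of_bool _)%:R.
  rewrite -finset.setI_eq0 finset.setIUl.
  have -> : (b :&: K = finset.set0)%SET.
    apply/eqP; rewrite finset.setI_eq0; apply: disjointWl bE _.
    by rewrite disjoint_sym.
  by rewrite finset.setU0; move/finset.setIidPl: aK => ->.
rewrite /Ex (bigD1 finset.set0) ?powersetE ?finset.sub0set //= eqxx mulr1.
rewrite big1 ?addr0 => [|a /andP[_ /negbTE->]]; last by rewrite mulr0.
by apply: eq_bigr => e _; rewrite inE.
Qed.

Hypothesis x01 : forall e, 0 <= x e <= 1.

Lemma activity_weight_ge0 E act : 0 <= activity_weight E x act.
Proof.
apply: prodr_ge0 => e _; have /andP[x0 x1] := x01 e.
by case: ifP; rewrite ?subr_ge0.
Qed.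

Lemma le_Ex E f g : {in powerset E, forall a, f a <= g a} -> Ex E f <= Ex E g.
Proof.
move=> fg; apply: ler_sum => a aE.
by apply: ler_wpM2l; [exact: activity_weight_ge0|exact: fg].
Qed.

End Expectation.

(** * Integration over the seed *)

Lemma sum_probability_le (R : realType) (d : measure_display)
    (T : measurableType d) (P : probability T R) (I : finType) (a : I -> R)
    (S : I -> set T) (B : R) :
  (forall i, 0 <= a i) -> (forall i, measurable (S i)) ->
  (forall w, \sum_i a i * \1_(S i) w <= B) ->
  \sum_i a i * fine (P (S i)) <= B.
Proof.
move=> a0 mS leB; rewrite -lee_fin -sumEFin.
have -> : (\sum_i (a i * fine (P (S i)))%:E =
           \int[P]_w (\sum_i (a i)%:E * (\1_(S i) w)%:E))%E.
  rewrite ge0_integral_sum //; first last.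
  - by move=> i w _; rewrite -EFinM lee_fin mulr_ge0.
  - move=> i; apply: measurable_funeM; apply/measurable_EFinP.
    exact: measurable_indic.
  apply: eq_bigr => i _; rewrite ge0_integralZl_EFin //; last first.
    by apply/measurable_EFinP; exact: measurable_indic.
  by rewrite integral_indic // setIT EFinM fineK // fin_num_measure.
have -> : (B%:E = \int[P]_w (cst B%:E w))%E.
  by rewrite integral_cst // -[RHS]/(B%:E * P setT)%E probability_setT mule1.
have sumE w : (\sum_i (a i)%:E * (\1_(S i) w)%:E =
               (\sum_i a i * \1_(S i) w)%:E)%E.
  by rewrite -sumEFin; apply: eq_bigr => i _; rewrite EFinM.
apply: ge0_le_integral => //.
- by move=> w _; rewrite sumE lee_fin sumr_ge0 // => i _; rewrite mulr_ge0.
- apply: emeasurable_sum => i; apply: measurable_funeM; apply/measurable_EFinP.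
  exact: measurable_indic.
- by move=> w _; rewrite sumE lee_fin.
Qed.

(** This reduces randomized schemes to deterministic ones: a bound on a nonnegative combination of
    selection probabilities that holds for each seed survives averaging. *)
Lemma sum_Pr_le (R : realType) (V : finType) (E : {set {set V}})
    (x : {set V} -> R) (A : ocrs R V) (J : finType) (c : J -> R)
    (ev : J -> seed A -> {set {set V}} -> bool) (B : R) :
  (forall e, 0 <= x e <= 1) -> (forall j, 0 <= c j) ->
  (forall j act, measurable [set w | ev j w act]) ->
  (forall w, \sum_j c j * Ex x E (fun act => (ev j w act)%:R) <= B) ->
  \sum_j c j * Pr E x (ev j) <= B.
Proof.
move=> x01 c0 mev leB.
(* The double sum becomes one sum over a finite type, with coefficient 0 for active sets not
   contained in [E]. *)
pose a (p : J * {set {set V}}) :=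
  if p.2 \in powerset E then c p.1 * activity_weight E x p.2 else 0.
pose S (p : J * {set {set V}}) := [set w | ev p.1 w p.2].
have sumE (F : J -> {set {set V}} -> R) :
    \sum_j c j * (\sum_(act in powerset E) activity_weight E x act * F j act)
    = \sum_p a p * F p.1 p.2.
  rewrite -(pair_bigA _ (fun j act => a (j, act) * F j act)) /=.
  apply: eq_bigr => j _; rewrite mulr_sumr big_mkcond; apply: eq_bigr => act _.
  by rewrite /a /=; case: ifP; rewrite ?mul0r ?mulrA.
rewrite /Pr sumE; apply: (@sum_probability_le _ _ _ _ _ a S).
- move=> p; rewrite /a; case: ifP => // _.
  by apply: mulr_ge0 => //; apply: activity_weight_ge0.
- by move=> p; exact: mev.
- move=> w; apply: le_trans (leB w); rewrite le_eqVlt; apply/orP; left.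
  apply/eqP; rewrite /Ex sumE; apply: eq_bigr => p _; congr (_ * _).
  by rewrite indicE /S; congr (nat_of_bool _)%:R; apply/idP/idP;
     rewrite ?inE.
Qed.


(** * The constant gamma and the scalar inequalities *)

Section Gamma.
Variable R : realType.
Implicit Types (g y z a b : R).

Definition gamma_fun g := 1 - 2 * g - g * expR (g - 1).

Lemma gamma_fun_decreasing g g' :
  0 < g -> g < g' -> gamma_fun g' < gamma_fun g.
Proof.
move=> g0 gg'; have : g * expR (g - 1) < g' * expR (g' - 1).
  apply: ltr_pM => //; [exact: ltW|].
  by rewrite ltr_expR ltrD2r.
by rewrite /gamma_fun; lra.
Qed.

(** One squaring step of the numerical estimates below; [b] is [a ^+ 2] rounded down, which keeps
    the numerals short. *)
Lemma expR_ge_sqr a b y : 0 <= a -> b <= a ^+ 2 ->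
  a <= expR y -> b <= expR (2 * y).
Proof.
move=> a0 ba ay; apply: le_trans ba _.
rewrite mulr_natl mulr2n expRD -expr2; apply: lerXn2r => //; rewrite nnegrE //.
Qed.

Lemma expR_le_inv a b y : 0 < a -> 1 <= a * b -> a <= expR (- y) -> expR y <= b.
Proof.
move=> a0 ab ay; apply: (@le_trans _ _ a^-1).
  by rewrite -[y]opprK expRN lef_pV2 ?posrE ?expR_gt0.
by rewrite -[leLHS]mul1r ler_pdivrMr // mulrC.
Qed.

(* [1 + y <= expR y] at [y = 0.60715 / 256], then eight squarings. *)
Lemma gamma_fun_lower : 0 < gamma_fun (3929 / 10 ^+ 4 - 5 / 10 ^+ 5).
Proof.
(* [x] is 1 minus the left endpoint 0.39285. The claim amounts to [expR (- x)] being below 0.2143 /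
   0.39285, about 0.5455. *)
have [x xE] : exists x : R, x = 607 / 10 ^+ 3 + 15 / 10 ^+ 5 by eexists.
have h8 : (1 + 2 / 10 ^+ 3 + 371 / 10 ^+ 6 + 679 / 10 ^+ 9) <= expR (x / 256) :> R.
  by apply: le_trans (expR_ge1Dx _); rewrite xE; lra.
have {h8}h7 : (1 + 4 / 10 ^+ 3 + 748 / 10 ^+ 6 + 982 / 10 ^+ 9) <= expR (x / 128) :> R.
  have -> : x / 128 = 2 * (x / 256) by lra.
  by apply: expR_ge_sqr h8; lra.
have {h7}h6 : (1 + 9 / 10 ^+ 3 + 520 / 10 ^+ 6 + 516 / 10 ^+ 9) <= expR (x / 64) :> R.
  have -> : x / 64 = 2 * (x / 128) by lra.
  by apply: expR_ge_sqr h7; lra.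
have {h6}h5 : (1 + 19 / 10 ^+ 3 + 131 / 10 ^+ 6 + 672 / 10 ^+ 9) <= expR (x / 32) :> R.
  have -> : x / 32 = 2 * (x / 64) by lra.
  by apply: expR_ge_sqr h6; lra.
have {h5}h4 : (1 + 38 / 10 ^+ 3 + 629 / 10 ^+ 6 + 364 / 10 ^+ 9) <= expR (x / 16) :> R.
  have -> : x / 16 = 2 * (x / 32) by lra.
  by apply: expR_ge_sqr h5; lra.
have {h4}h3 : (1 + 78 / 10 ^+ 3 + 750 / 10 ^+ 6 + 955 / 10 ^+ 9) <= expR (x / 8) :> R.
  have -> : x / 8 = 2 * (x / 16) by lra.
  by apply: expR_ge_sqr h4; lra.
have {h3}h2 : (1 + 163 / 10 ^+ 3 + 703 / 10 ^+ 6 + 622 / 10 ^+ 9) <= expR (x / 4) :> R.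
  have -> : x / 4 = 2 * (x / 8) by lra.
  by apply: expR_ge_sqr h3; lra.
have {h2}h1 : (1 + 354 / 10 ^+ 3 + 206 / 10 ^+ 6 + 119 / 10 ^+ 9) <= expR (x / 2) :> R.
  have -> : x / 2 = 2 * (x / 4) by lra.
  by apply: expR_ge_sqr h2; lra.
have {h1}h0 : (1 + 833 / 10 ^+ 3 + 874 / 10 ^+ 6 + 212 / 10 ^+ 9) <= expR x :> R.
  have -> : x = 2 * (x / 2) by lra.
  by apply: expR_ge_sqr h1; lra.
have {h0}h : expR (- x) <= 545 / 10 ^+ 3 + 4 / 10 ^+ 4.
  by rewrite -[x]opprK in h0; apply: expR_le_inv h0; lra.
rewrite /gamma_fun (_ : _ - 1 = - x); last by rewrite xE; lra.
lra.
Qed.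

(* [1 + y <= expR y] at [y = - 0.60705 / 4096], then twelve squarings. *)
Lemma gamma_fun_upper : gamma_fun (3929 / 10 ^+ 4 + 5 / 10 ^+ 5) < 0.
Proof.
have [x xE] : exists x : R, x = 607 / 10 ^+ 3 + 5 / 10 ^+ 5 by eexists.
(* Here [expR (- x)] has to exceed 0.2141 / 0.39295, about 0.54485. The margin is only about 0.0001,
   so a finer starting point is taken than for the lower endpoint. *)
have h12 : (999 / 10 ^+ 3 + 851 / 10 ^+ 6 + 794 / 10 ^+ 9) <= expR (- (x / 4096)) :> R.
  by apply: le_trans (expR_ge1Dx _); rewrite xE; lra.
have {h12}h11 : (999 / 10 ^+ 3 + 703 / 10 ^+ 6 + 609 / 10 ^+ 9) <= expR (- (x / 2048)) :> R.
  have -> : - (x / 2048) = 2 * (- (x / 4096)) by lra.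
  by apply: expR_ge_sqr h12; lra.
have {h11}h10 : (999 / 10 ^+ 3 + 407 / 10 ^+ 6 + 305 / 10 ^+ 9) <= expR (- (x / 1024)) :> R.
  have -> : - (x / 1024) = 2 * (- (x / 2048)) by lra.
  by apply: expR_ge_sqr h11; lra.
have {h10}h9 : (998 / 10 ^+ 3 + 814 / 10 ^+ 6 + 961 / 10 ^+ 9) <= expR (- (x / 512)) :> R.
  have -> : - (x / 512) = 2 * (- (x / 1024)) by lra.
  by apply: expR_ge_sqr h10; lra.
have {h9}h8 : (997 / 10 ^+ 3 + 631 / 10 ^+ 6 + 326 / 10 ^+ 9) <= expR (- (x / 256)) :> R.
  have -> : - (x / 256) = 2 * (- (x / 512)) by lra.
  by apply: expR_ge_sqr h9; lra.
have {h8}h7 : (995 / 10 ^+ 3 + 268 / 10 ^+ 6 + 262 / 10 ^+ 9) <= expR (- (x / 128)) :> R.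
  have -> : - (x / 128) = 2 * (- (x / 256)) by lra.
  by apply: expR_ge_sqr h8; lra.
have {h7}h6 : (990 / 10 ^+ 3 + 558 / 10 ^+ 6 + 913 / 10 ^+ 9) <= expR (- (x / 64)) :> R.
  have -> : - (x / 64) = 2 * (- (x / 128)) by lra.
  by apply: expR_ge_sqr h7; lra.
have {h6}h5 : (981 / 10 ^+ 3 + 206 / 10 ^+ 6 + 960 / 10 ^+ 9) <= expR (- (x / 32)) :> R.
  have -> : - (x / 32) = 2 * (- (x / 64)) by lra.
  by apply: expR_ge_sqr h6; lra.
have {h5}h4 : (962 / 10 ^+ 3 + 767 / 10 ^+ 6 + 98 / 10 ^+ 9) <= expR (- (x / 16)) :> R.
  have -> : - (x / 16) = 2 * (- (x / 32)) by lra.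
  by apply: expR_ge_sqr h5; lra.
have {h4}h3 : (926 / 10 ^+ 3 + 920 / 10 ^+ 6 + 484 / 10 ^+ 9) <= expR (- (x / 8)) :> R.
  have -> : - (x / 8) = 2 * (- (x / 16)) by lra.
  by apply: expR_ge_sqr h4; lra.
have {h3}h2 : (859 / 10 ^+ 3 + 181 / 10 ^+ 6 + 583 / 10 ^+ 9) <= expR (- (x / 4)) :> R.
  have -> : - (x / 4) = 2 * (- (x / 8)) by lra.
  by apply: expR_ge_sqr h3; lra.
have {h2}h1 : (738 / 10 ^+ 3 + 192 / 10 ^+ 6 + 992 / 10 ^+ 9) <= expR (- (x / 2)) :> R.
  have -> : - (x / 2) = 2 * (- (x / 4)) by lra.
  by apply: expR_ge_sqr h2; lra.
have {h1}h0 : (544 / 10 ^+ 3 + 928 / 10 ^+ 6 + 893 / 10 ^+ 9) <= expR (- x) :> R.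
  have -> : - x = 2 * (- (x / 2)) by lra.
  by apply: expR_ge_sqr h1; lra.
rewrite /gamma_fun (_ : _ - 1 = - x); last by rewrite xE; lra.
lra.
Qed.

Lemma gamma_exists : exists g, [/\ gamma_fun g = 0, 3929 / 10 ^+ 4 - 5 / 10 ^+ 5 < g &
  g < 3929 / 10 ^+ 4 + 5 / 10 ^+ 5].
Proof.
have cont : continuous gamma_fun.
  move=> g; rewrite /gamma_fun; apply: cvgB.
    by apply: cvgB; [exact: cvg_cst|apply: cvgMr; exact: cvg_id].
  apply: cvgM; first exact: cvg_id.
  apply: continuous_comp; last exact: continuous_expR.
  by apply: cvgB; [exact: cvg_id|exact: cvg_cst].
have [|||g] := @IVT R gamma_fun
  (3929 / 10 ^+ 4 - 5 / 10 ^+ 5) (3929 / 10 ^+ 4 + 5 / 10 ^+ 5) 0.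
- by lra.
- by apply: continuous_subspaceT.
- by rewrite ge_min le_max (ltW gamma_fun_lower) (ltW gamma_fun_upper) orbT.
rewrite in_itv /= => /andP[ag gb] g0; exists g; split => //; rewrite lt_neqAle.
  rewrite ag andbT; apply/eqP => gE.
  by have := gamma_fun_lower; rewrite gE g0 ltxx.
rewrite gb andbT; apply/eqP => gE.
by have := gamma_fun_upper; rewrite -gE g0 ltxx.
Qed.

Lemma gamma_unique g : 0 < g < 1 -> gamma_fun g = 0 -> unique (@gamma_eq R) g.
Proof.
move=> g01 g0; split=> // g' [/andP[g'0 _] g'E].
have := g0; rewrite /gamma_fun -g'E => gg'.
have [lt|lt|//] := ltgtP g g'.
  have := gamma_fun_decreasing (proj1 (andP g01)) lt.
  by rewrite /gamma_fun gg' ltxx.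
by have := gamma_fun_decreasing g'0 lt; rewrite /gamma_fun gg' ltxx.
Qed.

(* The right-hand side is the tangent of the left-hand side at [z = 1 - g]. *)
Lemma tangent_le g z : z <= 1 ->
  1 - (1 - z) * expR (- z) <=
  1 - g * expR (g - 1) + expR (g - 1) * (1 + g) * (z - (1 - g)).
Proof.
move=> z1; have -> : expR (- z) = expR (g - 1) * expR (- (z - (1 - g))).
  by rewrite -expRD; congr expR; ring.
have := expR_ge1Dx (- (z - (1 - g))).
have := expR_gt0 (g - 1); set k := expR (g - 1); set d := expR (- _) => k0 dge.
(* With [t = z - (1 - g)], the product [(1 - z) * (1 - t)] equals [g - (1 + g) * t + t ^+ 2], so the
   bound [1 - t <= d] leaves a square. *)
suff : 0 <= k * ((1 - z) * d - (g - (1 + g) * (z - (1 - g)))) by lra.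
apply: mulr_ge0; first exact: ltW.
have : (1 - z) * (1 - (z - (1 - g))) <= (1 - z) * d by apply: ler_wpM2l; lra.
by have := sqr_ge0 (z - (1 - g)); rewrite expr2; lra.
Qed.

(** With [N = n.+2], [1 - 1/N] is the inverse of [1 + 1/(N-1)], hence at least [expR (- 1/(N-1))].
    In its [m]-th power the exponent exceeds [m/N] by [m/(N(N-1)) <= 1/(N-1)], which costs a factor
    of at least [1 - 1/(N-1)]. *)
Lemma onem_inv_expn_ge n m : (m <= n.+2)%N ->
  expR (- (m%:R / n.+2%:R)) - n.+1%:R^-1 <= (1 - n.+2%:R^-1) ^+ m :> R.
Proof.
move=> mn.
have n0 : 0 < n.+1%:R :> R by rewrite ltr0n.
have n1 : n.+2%:R = n.+1%:R + 1 :> R by rewrite -natr1.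
have m0 : 0 <= m%:R :> R by rewrite ler0n.
have mn' : m%:R <= n.+2%:R :> R by rewrite ler_nat.
have base : expR (- n.+1%:R^-1) <= 1 - n.+2%:R^-1 :> R.
  have -> : 1 - n.+2%:R^-1 = (1 + n.+1%:R^-1)^-1 :> R by rewrite n1; field; lra.
  have i0 : 0 < 1 + n.+1%:R^-1 :> R by rewrite addr_gt0 // invr_gt0.
  by rewrite expRN lef_pV2 ?posrE ?expR_gt0 // expR_ge1Dx.
apply: (@le_trans _ _ (expR (- n.+1%:R^-1) ^+ m)); last first.
  by apply: lerXn2r => //; rewrite nnegrE ?expR_ge0 // (le_trans _ base) ?expR_ge0.
have -> : expR (- n.+1%:R^-1) ^+ m =
    expR (- (m%:R / n.+2%:R)) * expR (- (m%:R / n.+2%:R / n.+1%:R)) :> R.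
  rewrite -expRD -expRM_natr; congr expR; rewrite n1; field; lra.
have := expR_ge1Dx (- (m%:R / n.+2%:R / n.+1%:R) : R).
set d := expR (- (_ / _ / _)) => dge.
have q0 : 0 <= m%:R / n.+2%:R :> R by rewrite divr_ge0.
have q1 : m%:R / n.+2%:R <= 1 :> R by rewrite ler_pdivrMr ?ltr0n // mul1r.
have i0 : 0 < n.+1%:R^-1 :> R by rewrite invr_gt0.
have : expR (- (m%:R / n.+2%:R)) <= 1 :> R by rewrite -expR0 ler_expR oppr_le0.
have := expR_gt0 (- (m%:R / n.+2%:R) : R); set k := expR _ => k0 k1.
have dge' : 1 - n.+1%:R^-1 <= d.
  apply: le_trans dge; rewrite lerD2l lerN2 -[leRHS]mul1r.
  by apply: ler_wpM2r; [exact: ltW|].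
have : k * (1 - n.+1%:R^-1) <= k * d by apply: ler_wpM2l => //; exact: ltW.
have : k * n.+1%:R^-1 <= 1 * n.+1%:R^-1 by apply: ler_wpM2r => //; exact: ltW.
by move: (n.+1%:R^-1) => i; lra.
Qed.

End Gamma.

(** * Counting with indicators, and the edges of the tree *)

Lemma disjointN_common (T : finType) (v : T) (e f : {set T}) :
  v \in e -> v \in f -> ~~ [disjoint e & f]%B.
Proof. by move=> ve vf; apply/negP => /disjointFr/(_ ve); rewrite vf. Qed.

(** At most one term is nonzero. This is used for the edges of a matching at a common vertex. *)
Lemma sum_bool_le (R : numDomainType) (I : finType) (P b : pred I) (c : bool) :
  (forall i, P i -> b i -> c) ->
  (forall i j, P i -> P j -> b i -> b j -> i = j) ->
  \sum_(i | P i) (b i)%:R <= c%:R :> R.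
Proof.
move=> bc binj; case: (pickP (fun i => P i && b i)) => [i /andP[Pi bi]|b0].
  rewrite (bigD1 i) //= bi (bc i) // big1 ?addr0 // => j /andP[Pj ji].
  case: (boolP (b j)) => // bj; move: ji.
  by rewrite (binj j i) ?eqxx.
rewrite big1 // => i Pi; case: (boolP (b i)) => // bi.
by have := b0 i; rewrite Pi bi.
Qed.

Lemma sum_mem (R : numDomainType) (I : finType) (F : {set I}) :
  \sum_i (i \in F)%:R = #|F|%:R :> R.
Proof.
by rewrite -natr_sum -sum1_card [in RHS]big_mkcond.
Qed.

Lemma sum_notin (R : numDomainType) (I : finType) (F : {set I}) :
  \sum_i (i \notin F)%:R = #|I|%:R - #|F|%:R :> R.
Proof.
rewrite -(sum_mem R F) -sumr_const -sumrB; apply: eq_bigr => i _.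
by case: (i \in F); rewrite ?subrr ?subr0.
Qed.

Section TreeEdges.
Variable n : nat.

Definition root_edge (i : 'I_n) : {set tree_vertex n} := [set tree_u n; tree_v i]%SET.

Definition leaf_edge (i : 'I_n) (j : 'I_n.-1) : {set tree_vertex n} :=
  [set tree_v i; tree_w i j]%SET.

Lemma root_edge_inj : injective root_edge.
Proof.
move=> i k /finset.setP/(_ (tree_v i)); rewrite !inE eqxx orbT /=.
by move=> /esym/eqP[].
Qed.

Lemma leaf_edge_inj i i' j j' :
  leaf_edge i j = leaf_edge i' j' -> i = i' /\ j = j'.
Proof.
move=> /finset.setP/(_ (tree_w i j)); rewrite !inE eqxx orbT /=.
by move=> /esym/eqP[-> ->].
Qed.

Lemma root_edge_neq_leaf i k j : root_edge i != leaf_edge k j.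
Proof. by apply/eqP => /finset.setP/(_ (tree_u n)); rewrite !inE eqxx. Qed.

Lemma root_edge_in i : root_edge i \in root_edges n.
Proof. by apply/imsetP; exists i. Qed.

Lemma leaf_edge_in i j : leaf_edge i j \in leaf_edges n.
Proof. by apply/imset2P; exists i j. Qed.

Lemma leaf_root_disjoint : [disjoint leaf_edges n & root_edges n]%B.
Proof.
rewrite -finset.setI_eq0; apply/eqP/finset.setP => e; rewrite !inE.
apply/negP => /andP[/imset2P[k j _ _ ->] /imsetP[i _ /eqP]].
by rewrite eq_sym (negbTE (root_edge_neq_leaf _ _ _)).
Qed.

(** The adversary chooses only which root edge comes last; the order of the others is immaterial to
    the argument. *)
Definition other_roots i := rem (root_edge i) (enum (root_edges n)).

Definition last_order i := rcons (other_roots i) (root_edge i).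

Lemma last_order_is_order i : is_order (root_edges n) (last_order i).
Proof.
rewrite /is_order /last_order perm_rcons perm_sym; apply: perm_to_rem.
by rewrite mem_enum root_edge_in.
Qed.

Lemma mem_last_order i e : (e \in last_order i) = (e \in root_edges n).
Proof. by rewrite (perm_mem (last_order_is_order i)) mem_enum. Qed.

Lemma mem_other_roots i e :
  (e \in other_roots i) = (e != root_edge i) && (e \in root_edges n).
Proof. by rewrite mem_rem_uniq ?enum_uniq // inE mem_enum. Qed.

(** Only leaf edges count: a child matched to [u] is still in this set. *)
Definition free_children (M : {set {set tree_vertex n}}) : {set 'I_n} :=
  [set i | [forall j, leaf_edge i j \notin M]]%SET.

End TreeEdges.

(** * Combinatorics of a run on the tree with a fixed seed *)

Section DeterministicRun.
Variables (n : nat).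
Variable (acc : seq ({set tree_vertex n} * bool) -> {set tree_vertex n} -> bool).
Variable (s1 : seq {set tree_vertex n}).
Hypothesis s1P : is_order (leaf_edges n) s1.
Implicit Types (act b : {set {set tree_vertex n}}) (i k : 'I_n).

Let result act s := run acc act [::] finset.set0 s.
Let final i act := result act (s1 ++ last_order i).
Let before_last i act := result act (s1 ++ other_roots i).
Let free act := free_children (result act s1).
Let root_taken i act := [exists k, root_edge k \in before_last i act].

Lemma mem_s1 e : (e \in s1) = (e \in leaf_edges n).
Proof. by rewrite (perm_mem s1P) mem_enum. Qed.

Lemma result_disjoint act s :
  {in result act s &, forall e f : {set tree_vertex n}, e != f -> [disjoint e & f]%B}.
Proof. by apply: run_disjoint => e f; rewrite inE. Qed.

Lemma result_active act s e : e \in result act s -> e \in act.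
Proof. by case/mem_run => [|[]//]; rewrite inE. Qed.

Lemma result_catl act s t : result act s \subset result act (s ++ t).
Proof. by rewrite /result run_cat; apply: run_subset. Qed.

Lemma result_meet act s v e f : e \in result act s -> f \in result act s ->
  v \in e -> v \in f -> e = f.
Proof.
move=> eM fM ve vf; apply/eqP/negPn/negP => /(result_disjoint eM fM).
exact/negP/(disjointN_common ve).
Qed.

Lemma before_last_sub i act : before_last i act \subset final i act.
Proof. by rewrite /final /last_order -cats1 catA; exact: result_catl. Qed.

Lemma leaf_in_result act t k j : {subset t <= root_edges n} ->
  leaf_edge k j \in result act (s1 ++ t) -> leaf_edge k j \in result act s1.
Proof.
move=> tr; rewrite /result run_cat => /mem_run[//|[/tr + _]].
by rewrite (disjointFr (leaf_root_disjoint n)) ?leaf_edge_in.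
Qed.

Lemma root_in_before_last i k act : k != i ->
  root_edge k \in final i act -> root_edge k \in before_last i act.
Proof.
move=> ki; rewrite /final /last_order -cats1 catA /result run_cat.
case/mem_run => [//|[]]; rewrite inE => /eqP/root_edge_inj kiE.
by rewrite kiE eqxx in ki.
Qed.

Lemma freeP act k : reflect (exists j, leaf_edge k j \in result act s1)
  (k \notin free act).
Proof.
rewrite inE negb_forall; apply: (iffP existsP) => -[j].
  by rewrite negbK; exists j.
by exists j; rewrite negbK.
Qed.

Lemma root_in_final_free i k act : root_edge k \in final i act -> k \in free act.
Proof.
move=> kM; apply/negPn/negP => /freeP[j lM].
have lM' : leaf_edge k j \in final i act.
  exact: (fintype.subsetP (result_catl _ _ _)) lM.
have := result_meet (v := tree_v k) kM lM'.
rewrite !inE !eqxx ?orbT => /(_ isT isT)/eqP.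
by rewrite (negbTE (root_edge_neq_leaf _ _ _)).
Qed.

Lemma final_roots_eq i k k' act :
  root_edge k \in final i act -> root_edge k' \in final i act -> k = k'.
Proof.
move=> kM kM'; apply: root_edge_inj.
by apply: (result_meet (v := tree_u n) kM kM'); rewrite !inE eqxx.
Qed.

(** The conclusion separates the state of the last edge from conditions settled before it arrives,
    as [Ex_active] requires. An earlier root edge would meet the last one at [u]. *)
Lemma last_root_le i act :
  (root_edge i \in final i act) && (root_edge i \in act) ->
  [&& root_edge i \in act, i \in free act & ~~ root_taken i act].
Proof.
move=> /andP[iM ->]; rewrite (root_in_final_free iM) /=.
apply/negP => /existsP[k kN].
have kM := fintype.subsetP (before_last_sub i act) _ kN.
have kiE := final_roots_eq kM iM; subst k; case/mem_run: kN; first by rewrite inE.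
rewrite mem_cat mem_s1 mem_other_roots eqxx orbF.
by case; rewrite (disjointFl (leaf_root_disjoint n)) ?root_edge_in.
Qed.

Lemma before_last_free i k act : root_edge k \in before_last i act -> k \in free act.
Proof.
by move=> /(fintype.subsetP (before_last_sub i act)); apply: root_in_final_free.
Qed.

(** The leaf phase sees no root edge, so the set of free children is independent of the root
    states. *)
Lemma free_local act b : b \subset root_edges n -> free (act :|: b) = free act.
Proof.
move=> bR; rewrite /free /result (@eq_run _ _ _ act) // => e.
rewrite mem_s1 inE => eL; suff -> : e \in b = false by rewrite orbF.
apply/negP => /(fintype.subsetP bR).
by rewrite (disjointFr (leaf_root_disjoint n)).
Qed.

Lemma root_taken_local i act : root_taken i (root_edge i |: act) = root_taken i act.
Proof.
rewrite /root_taken /before_last /result (@eq_run _ _ _ act) // => e.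
rewrite in_setU1 mem_cat mem_s1 mem_other_roots.
case: eqP => //= ->; rewrite orbF.
by rewrite (disjointFl (leaf_root_disjoint n)) ?root_edge_in.
Qed.

(** * Weighted expected numbers of selected edges for a fixed seed *)

Section Weighted.
Variables (R : realType) (kappa : R).
Hypothesis kappa0 : 0 <= kappa.
Hypothesis n0 : (0 < n)%N.

Let x := @tree_x R n.
Let E := tree_edges n.
Let selected i e act : R := ((e \in final i act) && (e \in act))%:R.

Lemma tree_x01 e : 0 <= x e <= 1.
Proof. by rewrite invr_ge0 ler0n invf_le1 ?ler1n ?ltr0n. Qed.

Let nR0 : n%:R != 0 :> R. Proof. by rewrite pnatr_eq0 -lt0n. Qed.

Lemma sum_selected_leaves i act :
  \sum_k \sum_j selected i (leaf_edge k j) act <= n%:R - #|free act|%:R.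
Proof.
rewrite -[n in n%:R - _](card_ord n) -sum_notin.
apply: ler_sum => k _; apply: sum_bool_le => [j _|j j' _ _] /andP[lM _].
  apply/freeP; exists j; apply: leaf_in_result lM => e.
  by rewrite mem_last_order.
move=> /andP[lM' _].
have := result_meet (v := tree_v k) lM lM'; rewrite !inE !eqxx.
by move=> /(_ isT isT)/leaf_edge_inj[].
Qed.

Lemma sum_selected_other_roots i act :
  \sum_(k | k != i) selected i (root_edge k) act <= (root_taken i act)%:R.
Proof.
apply: sum_bool_le => [k ki|k k' _ _] /andP[kM _].
  by apply/existsP; exists k; apply: root_in_before_last.
by move=> /andP[kM' _]; exact: final_roots_eq kM kM'.
Qed.

(* Given its activity, the last edge succeeds only if [u] and its other endpoint are free,
   an event that does not depend on the activity. *)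
Lemma Ex_selected_last i :
  n%:R * Ex x E (selected i (root_edge i)) <=
  Ex x E (fun act => ((i \in free act) && ~~ root_taken i act)%:R).
Proof.
set f := fun act => _%:R.
suff : Ex x E (selected i (root_edge i)) <= x (root_edge i) * Ex x E f.
  by move=> h; rewrite -ler_pdivlMl ?ltr0n.
rewrite -Ex_active.
- apply: le_Ex; first exact: tree_x01.
  move=> act _; rewrite -natrM mulnb ler_nat.
  rewrite /selected; case: (boolP (_ && _)) => // /last_root_le.
  by rewrite /f => ->.
- by rewrite inE root_edge_in orbT.
- by move=> act; rewrite /f root_taken_local finset.setUC free_local //
     finset.sub1set root_edge_in.
Qed.

Let roots_of (F : {set 'I_n}) := [set root_edge k | k in F]%SET.

(** The factor [n] cancels the activity probability of the last edge, which puts its conditional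
    success and the earlier capture of [u] on the same scale. *)
Lemma Ex_selected_order i :
  n%:R * Ex x E (selected i (root_edge i)) +
  \sum_(k | k != i) Ex x E (selected i (root_edge k)) +
  kappa / n%:R * \sum_k \sum_j Ex x E (selected i (leaf_edge k j)) <=
  Ex x E (fun act => (i \in free act)%:R +
     (i \notin free act)%:R * (1 - [disjoint act & roots_of (free act)]%B%:R) +
     kappa / n%:R * (n%:R - #|free act|%:R)).
Proof.
have kn0 : 0 <= kappa / n%:R by rewrite divr_ge0.
have -> : \sum_k \sum_j Ex x E (selected i (leaf_edge k j)) =
    Ex x E (fun act => \sum_k \sum_j selected i (leaf_edge k j) act).
  by rewrite Ex_sum; apply: eq_bigr => k _; rewrite Ex_sum.
rewrite -Ex_sum -(Ex_scale _ _ (kappa / n%:R)) -addrA.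
apply: le_trans (lerD (Ex_selected_last i) (lexx _)) _; rewrite addrA.
rewrite -!Ex_add; apply: le_Ex; first exact: tree_x01.
move=> act _; apply: lerD; last first.
  by apply: ler_wpM2l => //; apply: sum_selected_leaves.
apply: (le_trans (lerD (lexx _) (sum_selected_other_roots i act))).
(* If [i] is free, the two terms are indicators of complementary events. Otherwise the last edge is
   lost, and [u] can be taken only through an active edge to a free child. *)
case: (boolP (i \in free act)) => iF /=.
  by case: (root_taken i act); rewrite ?mul0r ?addr0 ?add0r.
rewrite !add0r mul1r; case: (boolP (root_taken i act)) => [/existsP[k kN]|_].
  rewrite (negbTE (disjointN_common (result_active kN) _)) ?subr0 //.
  by apply: imset_f; apply: before_last_free kN.
by case: [disjoint _ & _]%B; rewrite ?subrr ?subr0.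
Qed.

(** Summing over [i] turns the indicators of free children into their number. Once the leaf states
    are fixed, that number is some [m], and all root edges to free children are inactive with
    probability [(1 - 1/n) ^+ m]. *)
Lemma Ex_selected_total (B : R) :
  (forall m, (m <= n)%N ->
     m%:R + (n%:R - m%:R) * (1 - (1 - n%:R^-1) ^+ m) + kappa * (n%:R - m%:R) <= B) ->
  \sum_i (n%:R * Ex x E (selected i (root_edge i)) +
          \sum_(k | k != i) Ex x E (selected i (root_edge k)) +
          kappa / n%:R * \sum_k \sum_j Ex x E (selected i (leaf_edge k j))) <= B.
Proof.
move=> leB; apply: le_trans (ler_sum _ (fun i _ => Ex_selected_order i)) _.
rewrite -Ex_sum.
pose g (F : {set 'I_n}) (d : R) : R :=
  #|F|%:R + (n%:R - #|F|%:R) * (1 - d) + kappa * (n%:R - #|F|%:R).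
rewrite (@eq_Ex _ _ _ _ _ (fun act => g (free act) [disjoint act & roots_of (free act)]%B%:R));
  last first.
  move=> act _; rewrite !big_split /= sum_mem -mulr_suml sum_notin card_ord.
  congr (_ + _ + _).
  rewrite sumr_const card_ord -[_ *+ n]mulr_natl; field; exact: nR0.
rewrite /E /tree_edges Ex_setU ?leaf_root_disjoint // -(Ex_cst x (leaf_edges n) B).
apply: le_Ex; first exact: tree_x01.
move=> a; rewrite powersetE => aL.
have KR : roots_of (free a) \subset root_edges n.
  by apply/fintype.subsetP => e /imsetP[k _ ->]; exact: root_edge_in.
rewrite (@eq_Ex _ _ _ _ _ (fun b => g (free a) [disjoint b & roots_of (free a)]%B%:R));
  last first.
  move=> b; rewrite powersetE => bR; rewrite free_local //.
  rewrite -!finset.setI_eq0 finset.setIUl.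
  have -> : (a :&: roots_of (free a) = finset.set0)%SET.
    apply/eqP; rewrite finset.setI_eq0.
    exact: disjointWl aL (disjointWr KR (leaf_root_disjoint n)).
  by rewrite finset.set0U.
(* Since [g] is affine in [d], the expectation over the root states passes to the avoidance
   indicator. *)
have affine (F : {set 'I_n}) d : g F d = g F 0 + (- (n%:R - #|F|%:R)) * d.
  by rewrite /g; ring.
rewrite (@eq_Ex _ _ _ _ _ _ (fun b _ => affine _ _)) Ex_add Ex_cst Ex_scale.
rewrite Ex_avoid // -affine.
rewrite (eq_bigr (fun=> 1 - n%:R^-1)) // prodr_const card_imset; last exact: root_edge_inj.
by apply: leB; rewrite -[n in (_ <= n)%N]card_ord max_card.
Qed.

End Weighted.
End DeterministicRun.

(** * Selectability and the final contradiction *)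

Lemma Pr_active (R : realType) (V : finType) (E : {set {set V}})
    (x : {set V} -> R) (A : ocrs R V) e : e \in E ->
  Pr E x (fun (_ : seed A) act => e \in act) = x e.
Proof.
move=> eE; transitivity (Ex x E (fun act => (e \in act)%:R * 1)).
  apply: eq_bigr => act _; rewrite mulr1; congr (_ * _).
  case: (e \in act).
    by rewrite (_ : [set _ | _] = setT) ?probability_setT //; apply/seteqP; split.
  by rewrite (_ : [set _ | _] = set0) ?measure0 //; apply/seteqP; split.
by rewrite (Ex_active x (f := fun=> 1)) // Ex_cst mulr1.
Qed.

Lemma lt_select_prob (R : realType) (V : finType) (E : {set {set V}})
    (x : {set V} -> R) (A : ocrs R V) s e c :
  e \in E -> 0 < x e -> c < selectability E x A s ->
  c * x e <= Pr E x (fun (w : seed A) act => (e \in matching s w act) && (e \in act)).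
Proof.
move=> eE x0 cs; have : c < select_prob E x A s e.
  by apply: lt_le_trans cs _; exact: bigmin_le_cond.
by rewrite /select_prob Pr_active // ltr_pdivlMr // => /ltW.
Qed.

(** After division by [n.+2], with [z] the free fraction, [onem_inv_expn_ge] costs at most
    [1 / n.+1]. In the tangent bound [kappa * z] cancels against [kappa * (1 - z)], and the equation
    of [g] turns the remaining [1 - g * expR (g - 1) + kappa * g] into [(2 + kappa) * g]. *)
Lemma seed_bound (R : realType) (g kappa : R) n m :
  kappa = expR (g - 1) * (1 + g) -> 0 < g < 1 -> gamma_fun g = 0 ->
  (m <= n.+2)%N ->
  m%:R + (n.+2%:R - m%:R) * (1 - (1 - n.+2%:R^-1) ^+ m) +
    kappa * (n.+2%:R - m%:R) <=
  n.+2%:R * ((2 + kappa) * g + n.+1%:R^-1) :> R.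
Proof.
move=> -> /andP[g0 g1] gE mn.
have N0 : 0 < n.+2%:R :> R by rewrite ltr0n.
have z1 : m%:R / n.+2%:R <= 1 :> R by rewrite ler_pdivrMr // mul1r ler_nat.
have z0 : 0 <= m%:R / n.+2%:R :> R by rewrite divr_ge0.
have mE : m%:R = n.+2%:R * (m%:R / n.+2%:R) :> R by rewrite mulrCA divff ?mulr1 ?gt_eqF.
have := tangent_le g z1; have := @onem_inv_expn_ge R n m mn.
move: gE; rewrite /gamma_fun [in X in _ -> _ -> _ -> X]mE.
have i0 : 0 < n.+1%:R^-1 :> R by rewrite invr_gt0 ltr0n.
move: (_ ^+ m) i0; move: (n.+1%:R^-1) => i q i0; move: N0.
clear mE; move: (n.+2%:R) z1 z0 => N.
move: (m%:R / N) => z; move: (expR (- z)) => ez; move: (expR (g - 1)) => eg.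
move=> z1 z0 N0 gE qe tan.
have : (1 - z) * (ez - i) <= (1 - z) * q by apply: ler_wpM2l => //; lra.
have : (1 - z) * i <= 1 * i by apply: ler_wpM2r => //; lra.
move=> h1 h2.
suff : z + (1 - z) * (1 - q) + eg * (1 + g) * (1 - z) <= (2 + eg * (1 + g)) * g + i.
  move=> h; have := ler_wpM2l (ltW N0) h; lra.
lra.
Qed.

Theorem theorem9 (R : realType) :
  exists gamma : R,
    [/\ unique (@gamma_eq R) gamma,
        `|gamma - 3929 / 10 ^+ 4| < 5 / 10 ^+ 5 &
        exists eps : nat -> R,
          (eps n @[n --> \oo] --> (0 : R)) /\
          forall n : nat, (2 <= n)%N ->
          forall (A : ocrs R (tree_vertex n))
                 (s1 : seq {set tree_vertex n}),
            is_order (leaf_edges n) s1 ->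
            exists s2 : seq {set tree_vertex n},
              is_order (root_edges n) s2 /\
              selectability (tree_edges n) (@tree_x R n) A (s1 ++ s2)
                <= gamma + eps n].
Proof.
have [g [gE glo ghi]] := gamma_exists R.
have g01 : 0 < g < 1 by apply/andP; split; lra.
exists g; split; first exact: gamma_unique.
  by rewrite ltr_norml; apply/andP; split; lra.
(* [harmonic n] is [1 / (n + 1)]. The constant 6 gives [n * eps n >= 4] for [n >= 2], enough to
   absorb all the error terms at the end. *)
exists (fun n => 6 * harmonic n); split.
  by rewrite -[0](mulr0 6); apply: cvgMr; exact: cvg_harmonic.
case=> [|[|n]] // _ A s1 s1P; set c := g + _; set E := tree_edges _; set x := @tree_x R n.+2.
suff [i leC] : exists i, selectability E x A (s1 ++ last_order i) <= c.
  by exists (last_order i); split => //; exact: last_order_is_order.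
apply: contrapT => /forallNP nle.
have lt_c i : c < selectability E x A (s1 ++ last_order i).
  by rewrite ltNge; apply/negP.
(* The default value 1 of the minimum bounds [c]; this controls the lower-order term
   [(1 + kappa) * c] below. *)
have c1 : c <= 1.
  by apply: ltW; apply: lt_le_trans (lt_c ord0) _; exact: bigmin_le_id.
pose kappa := expR (g - 1) * (1 + g).
have kappa0 : 0 < kappa by rewrite mulr_gt0 ?expR_gt0 //; lra.
pose N : R := n.+2%:R.
have N2 : 2 <= N by rewrite ler_nat.
(* [(i, inl k)] and [(i, inr (k, j))] stand for the selection of a root edge and of a leaf
   edge when the [i]-th root edge comes last. *)
pose J : finType := ('I_n.+2 * ('I_n.+2 + 'I_n.+2 * 'I_n.+1))%type.
pose coef (p : J) : R :=
  if p.2 is inl k then (if k == p.1 then N else 1) else kappa / N.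
pose edge (p : J) : {set tree_vertex n.+2} :=
  match p.2 with inl k => root_edge k | inr q => leaf_edge q.1 q.2 end.
pose ev (p : J) (w : seed A) act :=
  (edge p \in matching (s1 ++ last_order p.1) w act) && (edge p \in act).
have sumJ (F : J -> R) : \sum_p coef p * F p = \sum_i (N * F (i, inl i) +
    \sum_(k | k != i) F (i, inl k) +
    kappa / N * \sum_k \sum_j F (i, inr (k, j))).
  transitivity (\sum_i \sum_q coef (i, q) * F (i, q)).
    by rewrite pair_bigA; apply: eq_bigr => -[].
  apply: eq_bigr => i _; rewrite big_sumType /= (bigD1 i) //=; congr (_ + _ + _).
  - by rewrite /coef /= eqxx.
  - by apply: eq_bigr => k /negbTE ki; rewrite /coef /= ki mul1r.
  - by rewrite pair_bigA mulr_sumr; apply: eq_bigr => -[].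
(* The bound for a fixed seed concerns the sum over all choices of the last edge, so the orders are
   treated as one family when the seed is integrated out. *)
have upper : \sum_p coef p * Pr E x (ev p) <= N * ((2 + kappa) * g + n.+1%:R^-1).
  apply: sum_Pr_le.
  - by move=> e; exact: tree_x01.
  - move=> [i [k|q]]; rewrite /coef /=; last by rewrite divr_ge0 // ltW.
    by case: ifP.
  - move=> p act; rewrite /ev.
    exact: (@measurable_run _ _ A (fun M => (edge p \in M) && (edge p \in act)) act
      [::] finset.set0 (s1 ++ last_order p.1)).
  - move=> w; rewrite sumJ.
    have := @Ex_selected_total _ (@accept _ _ A w) _ s1P _ _ (ltW kappa0) isT.
    by apply => m mn; exact: seed_bound.
have lower : \sum_(p : J) coef p * (c * N^-1) <= \sum_p coef p * Pr E x (ev p).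
  apply: ler_sum => p _; apply: ler_wpM2l.
    case: p => [i [k|q]]; rewrite /coef /=; last by rewrite divr_ge0 // ltW.
    by case: ifP.
  apply: (@lt_select_prob _ _ E x A) (lt_c p.1) => //.
    rewrite inE /edge; case: p => i [k|q] /=.
      by rewrite root_edge_in orbT.
    by rewrite leaf_edge_in.
  by rewrite invr_gt0 ltr0n.
have N1 : n.+1%:R = N - 1 by rewrite /N -[n.+2]addn1 natrD addrK.
(* Each of the [N] orders has weight [N] for its last edge, 1 for each of the [N - 1] other root
   edges, and [kappa / N] for each of the [N * (N - 1)] leaf edges. *)
have total : \sum_(p : J) coef p * (c * N^-1) = (2 * N - 1 + kappa * (N - 1)) * c.
  transitivity (\sum_(i < n.+2) (N * (c / N) + (N - 1) * (c / N) +
                                 kappa / N * (N * ((N - 1) * (c / N))))).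
    rewrite sumJ; apply: eq_bigr => i _; congr (_ + _ + _ * _).
      have : \sum_(k < n.+2) c / N = N * (c / N).
        by rewrite sumr_const card_ord mulr_natl.
      by rewrite (bigD1 i) //= mulrBl mul1r => <-; rewrite addrAC subrr add0r.
    have -> : N * ((N - 1) * (c / N)) = \sum_(k < n.+2) (N - 1) * (c / N).
      by rewrite sumr_const card_ord mulr_natl.
    by apply: eq_bigr => k _; rewrite sumr_const card_ord -N1 mulr_natl.
  by rewrite sumr_const card_ord -[_ *+ _]mulr_natl -/N; field; lra.
have h0 : 0 <= 6 * harmonic n.+2 :> R by rewrite mulr_ge0 // invr_ge0.
have hN : N * (6 * harmonic n.+2) = 6 - 6 * harmonic n.+2.
  by rewrite /= -[n.+3]addn1 natrD -/N; field; lra.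
have h2 : 6 * harmonic n.+2 <= 2 :> R.
  by have := ler_wpM2r h0 N2; rewrite hN; lra.
have i1 : N * (N - 1)^-1 <= 2.
  by rewrite ler_pdivrMr; lra.
have := le_trans lower upper; rewrite total N1 [X in _ <= X]mulrDr.
move: c1 hN h0 h2; rewrite /c; move: (6 * harmonic n.+2) i1 => h.
move: (N * (N - 1)^-1) => r r2 c1 hN h0 h2.
(* The main terms [N * ((2 + kappa) * g)] cancel. What remains on the left is at least
   [4 * (2 + kappa) - (1 + kappa)], which exceeds the bound 2 on [r]. *)
have -> : (2 * N - 1 + kappa * (N - 1)) * (g + h) =
  N * ((2 + kappa) * g) + (2 + kappa) * (N * h) - (1 + kappa) * (g + h) by ring.
have : (2 + kappa) * 4 <= (2 + kappa) * (N * h) by apply: ler_wpM2l; lra.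
have : (1 + kappa) * (g + h) <= (1 + kappa) * 1 by apply: ler_wpM2l; lra.
lra.
Qed.
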